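(* If $n=2\nu$ is even, then $M\in\mathbb{R}^{n\times n}$ is an element of $M_n$ if and only if $$M=\mathcal{X}_n\begin{pmatrix}\mathcal{O}_\nu&a\sigma_\nu^T\\ \sigma_\nu b^T&Z\end{pmatrix}\mathcal{X}_n$$ for some $Z\in M_\nu$ and $a,b\in\mathbb{R}^\nu$. If $n=2\nu+1$ is odd, then, with $\varepsilon=(-1)^\nu$, $M\in\mathbb{R}^{n\times n}$ is an element of $M_n$ if and only if $$M=\mathcal{X}_n\begin{pmatrix}\varepsilon\sqrt2\,(v\sigma_\nu^T+\sigma_\nu y^T)-\varepsilon\frac{2\sqrt2}{2\nu-1}\,(\sigma_\nu^T(v+y))\,\sigma_\nu\sigma_\nu^T&v&\varepsilon\sqrt2\,\sigma_\nu z^T\\ y^T&\frac{\varepsilon\sqrt2}{2\nu-1}\,\sigma_\nu^T(v+y)&z^T\\ \varepsilon\sqrt2\,x\sigma_\nu^T&x&\mathcal{O}_\nu\end{pmatrix}\mathcal{X}_n$$ with arbitrary $v,x,y,z\in\mathbb{R}^\nu$.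
   Context: $\sigma_n\in\mathbb{R}^n$ is the column vector with $j$th entry $(-1)^{j-1}$; $X^\bot=\{u\in\mathbb{R}^n\mid u^Tv=0\ (v\in X)\}$. For even $n$, $M_n$ is the space of matrices $M\in\mathbb{R}^{n\times n}$ with $M_{i,j}+M_{i,j+1}+M_{i+1,j}+M_{i+1,j+1}=0$ for all $i,j\in\mathbb{Z}_n=\mathbb{Z}/n\mathbb{Z}$ (indices modulo $n$) and $\sum_{i,j\in\mathbb{Z}_n}(-1)^{i+j}M_{i,j}=0$. For odd $n$, $M_n=\{M\in\mathbb{R}^{n\times n}\mid u^TMv=0\ (u,v\in\{\sigma_n\}^\bot),\ \sigma_n^TM\sigma_n=0\}$. $0_\nu\in\mathbb{R}^\nu$ is the null column vector; $\mathcal{O}_\nu$ is the $\nu\times\nu$ null matrix; $\mathcal{I}_\nu$ is the $\nu\times\nu$ unit matrix; $\mathcal{J}_\nu=(\delta_{i,\nu+1-j})_{i,j=1}^\nu$ (ones on the antidiagonal, zeros elsewhere); and $$\mathcal{X}_n=\frac1{\sqrt2}\begin{pmatrix}\mathcal{I}_\nu&\mathcal{J}_\nu\\ \mathcal{J}_\nu&-\mathcal{I}_\nu\end{pmatrix}\ (n=2\nu),\qquad \mathcal{X}_n=\begin{pmatrix}\frac1{\sqrt2}\mathcal{I}_\nu&0_\nu&\frac1{\sqrt2}\mathcal{J}_\nu\\ 0_\nu^T&1&0_\nu^T\\ \frac1{\sqrt2}\mathcal{J}_\nu&0_\nu&-\frac1{\sqrt2}\mathcal{I}_\nu\end{pmatrix}\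 (n=2\nu+1).$$ *)

(* Defs.v *)
From mathcomp Require Import all_boot all_order all_algebra.
From mathcomp Require Import classical_sets reals.

Set Implicit Arguments.
Unset Strict Implicit.
Unset Printing Implicit Defensive.

Import Order.TTheory GRing.Theory Num.Theory.

Local Open Scope ring_scope.
Local Open Scope classical_set_scope.

(* Indices are 0-based throughout, so the 1-based sign (-1)^(j-1) is (-1) ^+ j. *)
Definition sigma (R : realType) (n : nat) : 'cV[R]_n := \col_(j < n) (-1) ^+ j.
Arguments sigma {R} n.

Definition orth (R : realType) (n : nat) (X : set 'cV[R]_n) : set 'cV[R]_n :=
  [set u | forall v, X v -> u^T *m v = 0].

(* [ordS] is the cyclic successor on 'I_n, i.e. i |-> i + 1 in Z/nZ. *)
Definition Mspace_even (R : realType) (n : nat) : set 'M[R]_n :=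
  [set M | (forall i j : 'I_n,
              M i j + M i (ordS j) + M (ordS i) j + M (ordS i) (ordS j) = 0)
           /\ \sum_(i < n) \sum_(j < n) (-1) ^+ (i + j) * M i j = 0].

Definition Mspace_odd (R : realType) (n : nat) : set 'M[R]_n :=
  [set M | (forall u v : 'cV[R]_n,
              orth [set sigma n] u -> orth [set sigma n] v -> u^T *m M *m v = 0)
           /\ (sigma n)^T *m M *m sigma n = 0].

Definition Mspace (R : realType) (n : nat) : set 'M[R]_n :=
  if odd n then @Mspace_odd R n else @Mspace_even R n.
Arguments Mspace R n : clear implicits.

Definition Jmx (R : realType) (nu : nat) : 'M[R]_nu :=
  \matrix_(i < nu, j < nu) (i == rev_ord j)%:R.
Arguments Jmx {R} nu.

Definition block3_mx (R : realType) (m1 m2 m3 n1 n2 n3 : nat)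
    (A11 : 'M[R]_(m1, n1)) (A12 : 'M[R]_(m1, n2)) (A13 : 'M[R]_(m1, n3))
    (A21 : 'M[R]_(m2, n1)) (A22 : 'M[R]_(m2, n2)) (A23 : 'M[R]_(m2, n3))
    (A31 : 'M[R]_(m3, n1)) (A32 : 'M[R]_(m3, n2)) (A33 : 'M[R]_(m3, n3)) :
    'M[R]_(m1 + (m2 + m3), n1 + (n2 + n3)) :=
  block_mx A11               (row_mx A12 A13)
           (col_mx A21 A31)  (block_mx A22 A23 A32 A33).

Definition Xmx_even (R : realType) (nu : nat) : 'M[R]_(nu + nu) :=
  (Num.sqrt 2)^-1 *: block_mx 1%:M (Jmx nu) (Jmx nu) (- 1%:M).
Arguments Xmx_even {R} nu.

Definition Xmx_odd (R : realType) (nu : nat) : 'M[R]_(nu + (1 + nu)) :=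
  let s : R := (Num.sqrt 2)^-1 in
  block3_mx (s *: 1%:M)   0     (s *: Jmx nu)
            0             1%:M  0
            (s *: Jmx nu) 0     (- s *: 1%:M).
Arguments Xmx_odd {R} nu.

Definition dotc (R : realType) (n : nat) (u v : 'cV[R]_n) : R := (u^T *m v) 0 0.

(* Main.v *)
(** For either parity of n, M lies in M_n iff M = a sigma_n^T + sigma_n b^T with
    (a + b)^T sigma_n = 0.  For n odd, compress M by the orthogonal projection
    onto the complement of sigma_n; for n even, the sums of two consecutive rows
    alternate in sign, which determines M from its first row and column.
    As X_n is a symmetric involution, conjugating by it replaces sigma_n by
    X_n sigma_n, which is (0; - (-1)^nu sqrt 2 sigma_nu) for n = 2nu and
    (sqrt 2 sigma_nu; (-1)^nu; 0) for n = 2nu+1; read off the blocks. *)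
Require Import Defs.
From mathcomp Require Import all_boot all_order all_algebra.
From mathcomp Require Import classical_sets reals ring.

Set Implicit Arguments.
Unset Strict Implicit.
Unset Printing Implicit Defensive.

Import Order.TTheory GRing.Theory Num.Theory.

Local Open Scope ring_scope.

Section SigmaSums.
Variable R : realType.

(** * Inner products, the alternating vector and index reversal *)

Lemma trmx_scale m n c (A : 'M[R]_(m, n)) : (c *: A)^T = c *: A^T.
Proof. exact: linearZ. Qed.

Lemma outerE m n (u : 'cV[R]_m) (v : 'cV[R]_n) i j :
  (u *m v^T) i j = u i 0 * v j 0.
Proof. by rewrite mxE big_ord1 mxE. Qed.

Lemma dotcE n (u v : 'cV[R]_n) : dotc u v = \sum_i u i 0 * v i 0.
Proof. by rewrite /dotc mxE; apply: eq_bigr => i _; rewrite mxE. Qed.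

Lemma dotc_mx n (u v : 'cV[R]_n) : u^T *m v = (dotc u v)%:M.
Proof. by apply/matrixP => i j; rewrite !ord1 [RHS]mxE. Qed.

Lemma dotcC n (u v : 'cV[R]_n) : dotc u v = dotc v u.
Proof. by rewrite !dotcE; apply: eq_bigr => i _; rewrite mulrC. Qed.

Lemma dotcDl n (u v w : 'cV[R]_n) : dotc (u + v) w = dotc u w + dotc v w.
Proof. by rewrite /dotc linearD mulmxDl mxE. Qed.

Lemma dotcZl n c (u v : 'cV[R]_n) : dotc (c *: u) v = c * dotc u v.
Proof. by rewrite /dotc linearZ /= -scalemxAl mxE. Qed.

Lemma dotcDr n (u v w : 'cV[R]_n) : dotc u (v + w) = dotc u v + dotc u w.
Proof. by rewrite /dotc mulmxDr mxE. Qed.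

Lemma dotcZr n c (u v : 'cV[R]_n) : dotc u (c *: v) = c * dotc u v.
Proof. by rewrite /dotc -scalemxAr mxE. Qed.

Lemma dotc_col_mx m n (a c : 'cV[R]_m) (b d : 'cV[R]_n) :
  dotc (col_mx a b) (col_mx c d) = dotc a c + dotc b d.
Proof. by rewrite /dotc tr_col_mx mul_row_col mxE. Qed.

Lemma dotc0r n (u : 'cV[R]_n) : dotc u 0 = 0.
Proof. by rewrite /dotc mulmx0 mxE. Qed.

Lemma dotc_scalar (a b : R) : dotc (a%:M : 'cV[R]_1) b%:M = a * b.
Proof. by rewrite dotcE big_ord1 !mxE. Qed.

Lemma sigma_sq n (i : 'I_n) : sigma n i 0 * sigma n i 0 = 1 :> R.
Proof. by rewrite mxE -expr2 sqrr_sign. Qed.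

Lemma dotc_sigma n : dotc (sigma n) (sigma n) = n%:R :> R.
Proof.
rewrite dotcE (eq_bigr (fun=> 1)) => [|i _]; last exact: sigma_sq.
by rewrite sumr_const card_ord.
Qed.

(** For even n, reduction modulo n preserves parity, so the sign also flips at the wrap-around. *)
Lemma sigma_ordS n (i : 'I_n) : ~~ odd n ->
  sigma n (ordS i) 0 = - sigma n i 0 :> R.
Proof.
move=> /negPf n_even; rewrite !mxE /= -signr_odd odd_mod ?n_even //.
by rewrite signr_odd exprS mulN1r.
Qed.

Lemma sigma_add m n : sigma (m + n) =
  col_mx (sigma m) ((-1) ^+ m *: sigma n) :> 'cV[R]_(m + n).
Proof.
apply/colP => i; rewrite !mxE.
by case: (split_ordP i) => j ->; rewrite !mxE //= exprD.
Qed.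

Lemma sigma1 : sigma 1 = 1%:M :> 'cV[R]_1.
Proof. by apply/colP => i; rewrite !mxE ord1. Qed.

Lemma Jmx_mulE n p (A : 'M[R]_(n, p)) i j : (Jmx n *m A) i j = A (rev_ord i) j.
Proof.
rewrite mxE (bigD1 (rev_ord i)) //= mxE rev_ordK eqxx mul1r big1 ?addr0 // => k.
by rewrite mxE -(inj_eq rev_ord_inj) rev_ordK eq_sym => /negPf->; rewrite mul0r.
Qed.

(** Reversal sends i to n - 1 - i, which has the parity of n + 1 + i. *)
Lemma Jmx_sigma n : Jmx n *m sigma n = - (-1) ^+ n *: sigma n :> 'cV[R]_n.
Proof.
apply/colP => i; rewrite Jmx_mulE !mxE /=.
have -> : (-1) ^+ n = - ((-1) ^+ (n - i.+1) * (-1) ^+ i) :> R.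
  by rewrite -exprD -[RHS]mulN1r -exprS -addnS subnK.
by rewrite opprK -mulrA -expr2 sqrr_sign mulr1.
Qed.

Lemma JmxK n : Jmx n *m Jmx n = 1%:M :> 'M[R]_n.
Proof.
by apply/matrixP => i j; rewrite Jmx_mulE !mxE (inj_eq rev_ord_inj).
Qed.

Lemma tr_Jmx n : (Jmx n)^T = Jmx n :> 'M[R]_n.
Proof.
by apply/matrixP => i j; rewrite !mxE -(inj_eq rev_ord_inj) rev_ordK eq_sym.
Qed.

(** Induction from 0 up to i, along which the cyclic successor never wraps around. *)
Lemma alternating_ordS n (f : 'I_n.+1 -> R) :
  (forall i, f (ordS i) = - f i) -> forall i, f i = (-1) ^+ i * f ord0.
Proof.
move=> fS [i]; elim: i => [|i IHi] lt_i /=.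
  by rewrite mul1r; congr f; apply: val_inj.
have lt_i' := ltnW lt_i.
have -> : Ordinal lt_i = ordS (Ordinal lt_i').
  by apply: val_inj; rewrite /= modn_small.
by rewrite fS IHi exprS mulN1r mulNr.
Qed.

(** * Description of M_n by pairs of vectors, for each parity *)

Definition sigma_sum n (a b : 'cV[R]_n) : 'M[R]_n :=
  a *m (sigma n)^T + sigma n *m b^T.

Lemma sigma_sumE n (a b : 'cV[R]_n) i j :
  sigma_sum a b i j = a i 0 * sigma n j 0 + sigma n i 0 * b j 0.
Proof. by rewrite [LHS]mxE !outerE. Qed.

(** For n > 0 this turns the vanishing of the form at sigma_n into the linear condition on a and
    b. *)
Lemma sigma_form n (a b : 'cV[R]_n) :
  ((sigma n)^T *m sigma_sum a b *m sigma n) 0 0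
  = n%:R * (dotc a (sigma n) + dotc b (sigma n)).
Proof.
rewrite mulmxDr mulmxDl -!mulmxA (dotc_mx (sigma n) (sigma n)) (dotc_mx b).
rewrite !mul_mx_scalar -!scalemxAr !dotc_mx.
rewrite dotc_sigma (dotcC _ a) !mxE eqxx !mulr1n; ring.
Qed.

Lemma Mspace_oddP n (M : 'M[R]_n) : odd n ->
  Mspace_odd M <-> exists a b, M = sigma_sum a b /\
    dotc a (sigma n) + dotc b (sigma n) = 0.
Proof.
move=> n_odd; have n0 : n%:R != 0 :> R by rewrite pnatr_eq0; case: n n_odd {M}.
split=> [[M0 Ms]|[a [b [-> ab0]]]]; last first.
  split=> [u v uo vo|].
    have u0 := uo _ (erefl _); have v0 := vo _ (erefl _).
    rewrite /sigma_sum mulmxDr mulmxDl !mulmxA u0 !mul0mx addr0.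
    by rewrite -mulmxA -[_^T *m v]trmxK trmx_mul trmxK v0 trmx0 mulmx0.
  apply/matrixP => i j; rewrite !ord1 sigma_form ab0 mulr0.
  by rewrite mxE.
pose s : 'cV[R]_n := sigma n.
have ss : s^T *m s = (n%:R)%:M.
  by apply/matrixP => i j; rewrite !ord1 [LHS]dotc_sigma mxE.
(* The orthogonal projection onto the complement of s: its columns may be put into the hypothesis
   [M0], whence P M P = 0. *)
pose P : 'M[R]_n := 1%:M - n%:R^-1 *: (s *m s^T).
have Ps : P *m s = 0.
  rewrite mulmxBl mul1mx -scalemxAl -mulmxA ss mul_mx_scalar scalerA mulVf //.
  by rewrite scale1r subrr.
have PT : P^T = P by rewrite linearB linearZ /= trmx_mul trmxK trmx1.
have Po (k : 'I_n) : orth [set s] (P *m delta_mx k (0 : 'I_1)).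
  by move=> _ ->; rewrite trmx_mul PT -mulmxA Ps mulmx0.
have PMP : P *m M *m P = 0.
  apply/matrixP => i j; move/matrixP/(_ 0 0): (M0 _ _ (Po i) (Po j)).
  rewrite trmx_mul PT trmx_delta -!mulmxA -rowE mxE !mulmxA -colE !mxE.
  by [].
pose Q : 'M[R]_n := n%:R^-1 *: (s *m s^T).
have QMQ : Q *m M *m Q = 0.
  rewrite /Q -scalemxAr -!scalemxAl !mulmxA -(mulmxA s) -(mulmxA s) Ms.
  by rewrite mulmx0 mul0mx !scaler0.
(* Since P = 1 - Q and Q M Q = 0, expanding P M P = 0 gives M = M Q + Q M; these two terms are a s^T
   and s b^T. *)
exists (n%:R^-1 *: (M *m s)), (n%:R^-1 *: (M^T *m s)); split.
  move: PMP; rewrite /P -/Q mulmxBr mulmx1 mulmxBl mul1mx mulmxBl QMQ subr0.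
  move/eqP; rewrite -addrA -opprD subr_eq0 => /eqP Me; rewrite [LHS]Me.
  rewrite addrC /Q /sigma_sum trmx_scale trmx_mul trmxK.
  by rewrite -!scalemxAl -!scalemxAr !mulmxA.
have sMs : dotc s (M *m s) = 0 by rewrite /dotc mulmxA Ms mxE.
rewrite !dotcZl (dotcC (M *m s)) sMs /dotc trmx_mul trmxK -mulmxA.
by rewrite -/(dotc _ _) sMs !mulr0 addr0.
Qed.

Lemma Mspace_evenP n (M : 'M[R]_n) : ~~ odd n ->
  Mspace_even M <-> exists a b, M = sigma_sum a b /\
    dotc a (sigma n) + dotc b (sigma n) = 0.
Proof.
have trE (N : 'M[R]_n) : \sum_(i < n) \sum_(j < n) (-1) ^+ (i + j) * N i j =
    ((sigma n)^T *m N *m sigma n) 0 0.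
  rewrite -mulmxA mxE; apply: eq_bigr => i _; rewrite !mxE mulr_sumr.
  by apply: eq_bigr => j _; rewrite !mxE exprD; ring.
move=> n_even; split=> [[MS Ms]|[a [b [-> ab0]]]]; last first.
  split=> [i j|]; last by rewrite trE sigma_form ab0 mulr0.
  rewrite !sigma_sumE !sigma_ordS //; ring.
case: n M n_even trE MS Ms => [|n] M n_even trE MS Ms.
  by exists 0, 0; split; [apply/matrixP => -[] | rewrite dotcE big_ord0 addr0].
(* For fixed j, the sum of columns j and j + 1 alternates down the rows. *)
have MS0 j : forall i,
    M i j + M i (ordS j) = (-1) ^+ i * (M ord0 j + M ord0 (ordS j)).
  apply: alternating_ordS => i; apply/eqP.
  by rewrite -addr_eq0 -(MS i j); apply/eqP; ring.
(* By [MS0], subtracting (-1)^i times row 0 from row i leaves a row whose consecutive entries are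
   opposite. *)
have ME i : forall j, M i j - (-1) ^+ i * M ord0 j
    = (-1) ^+ j * (M i ord0 - (-1) ^+ i * M ord0 ord0).
  apply: (@alternating_ordS _ (fun j => M i j - (-1) ^+ i * M ord0 j)) => j.
  apply/eqP; rewrite -addr_eq0; apply/eqP.
  by rewrite -[RHS](subrr (M i j + M i (ordS j))) {2}MS0; ring.
(* Solving [ME] for M i j: b is the first row, and a the first column with the corner's share
   removed, so that the corner counts once. *)
pose a : 'cV[R]_n.+1 := \col_i (M i ord0 - (-1) ^+ i * M ord0 ord0).
pose b : 'cV[R]_n.+1 := \col_j M ord0 j.
have Me : M = sigma_sum a b.
  apply/matrixP => i j; rewrite sigma_sumE !mxE.
  by rewrite (mulrC (_ - _)) -ME subrK.
exists a, b.
split=> //; move: Ms; rewrite trE [X in _ *m X *m _]Me sigma_form.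
by move/eqP; rewrite mulf_eq0 pnatr_eq0 => /eqP.
Qed.

Lemma MspaceP n (M : 'M[R]_n) :
  Mspace R n M <-> exists a b, M = sigma_sum a b /\
    dotc a (sigma n) + dotc b (sigma n) = 0.
Proof.
rewrite /Mspace; have [n_odd|n_even] := boolP (odd n); first exact: Mspace_oddP.
exact: Mspace_evenP.
Qed.

(** Replace a and b by X a and X b; a symmetric X moves across the inner product, and X X = 1
    cancels. *)
Lemma Mspace_conjP n (X M : 'M[R]_n) : X^T = X -> X *m X = 1%:M ->
  Mspace R n M <-> exists a b,
    M = X *m (a *m (X *m sigma n)^T + (X *m sigma n) *m b^T) *m X /\
    dotc a (X *m sigma n) + dotc b (X *m sigma n) = 0.
Proof.
move=> XT XX; have dotX u v : dotc (X *m u) v = dotc u (X *m v).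
  by rewrite /dotc trmx_mul XT mulmxA.
have XK m (u : 'M[R]_(n, m)) : X *m (X *m u) = u by rewrite mulmxA XX mul1mx.
split=> [/MspaceP[a [b [-> ab0]]]|[a [b [-> ab0]]]].
  exists (X *m a), (X *m b); split; last by rewrite !dotX !XK.
  rewrite /sigma_sum !trmx_mul XT mulmxDr mulmxDl -!mulmxA !XK.
  by rewrite XX !mulmx1.
apply/MspaceP; exists (X *m a), (X *m b); split; last by rewrite !dotX.
rewrite /sigma_sum !trmx_mul XT mulmxDr mulmxDl -!mulmxA !XK.
by rewrite XX !mulmx1.
Qed.

(** * The matrices X_n and their action on sigma_n *)

Let r : R := Num.sqrt 2.

Lemma sqrt2_sqr : r * r = 2.
Proof. by rewrite -expr2 sqr_sqrtr. Qed.

Lemma sqrt2_neq0 : r != 0.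
Proof. by rewrite gt_eqF // sqrtr_gt0. Qed.

Lemma sqrt2V_sqr : r^-1 * r^-1 = 2^-1.
Proof. by rewrite -invfM sqrt2_sqr. Qed.

Lemma scale_halfD m n (A : 'M[R]_(m, n)) : 2^-1 *: A + 2^-1 *: A = A.
Proof. by rewrite -scalerDl -[in RHS](scale1r A); congr (_ *: _); field. Qed.

Lemma sqrt2_half : r^-1 * 2 = r.
Proof. by rewrite -sqrt2_sqr mulKf // sqrt2_neq0. Qed.

Lemma Xmx_even_tr nu : (Xmx_even nu)^T = Xmx_even nu :> 'M[R]_(nu + nu).
Proof.
by rewrite linearZ /= tr_block_mx !tr_Jmx trmx1 linearN /= trmx1.
Qed.

Lemma Xmx_evenK nu : Xmx_even nu *m Xmx_even nu = 1%:M :> 'M[R]_(nu + nu).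
Proof.
rewrite -scalemxAl -scalemxAr scalerA sqrt2V_sqr mulmx_block !JmxK.
rewrite !(mulmx1, mul1mx, mulmxN, mulNmx) !opprK subrr.
by rewrite scale_block_mx !scaler0 !scalerDr !scale_halfD -scalar_mx_block.
Qed.

(** By [Jmx_sigma], the contributions of the two halves of sigma cancel in the upper block and
    double in the lower one. *)
Lemma Xmx_even_sigma nu :
  Xmx_even nu *m sigma (nu + nu) =
  col_mx 0 ((- (-1) ^+ nu * r) *: sigma nu) :> 'cV[R]_(nu + nu).
Proof.
rewrite sigma_add -scalemxAl mul_block_col -!scalemxAr !Jmx_sigma.
rewrite mul1mx mulNmx mul1mx scale_col_mx scalerA mulrN -expr2 sqrr_sign.
rewrite scaleN1r subrr scaler0 scalerN -scaleNr -scalerDl scalerA.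
by rewrite -sqrt2_half; congr (col_mx _ (_ *: _)); ring.
Qed.

Lemma Xmx_odd_tr nu : (Xmx_odd nu)^T = Xmx_odd nu :> 'M[R]_(nu + (1 + nu)).
Proof.
rewrite /Xmx_odd /block3_mx !(tr_block_mx, tr_row_mx, tr_col_mx) !linearZ /=.
by rewrite !tr_Jmx !trmx1 !trmx0.
Qed.

Lemma Xmx_oddK nu : Xmx_odd nu *m Xmx_odd nu = 1%:M :> 'M[R]_(nu + (1 + nu)).
Proof.
rewrite /Xmx_odd /block3_mx !(mulmx_block, mul_row_col, mul_col_row, mul_mx_row,
  mul_row_block, mul_block_col, mul_col_mx).
rewrite !(mulmx0, mul0mx, add0r, addr0, mulmx1, mul1mx).
rewrite -!scalemxAl -!scalemxAr !JmxK !mulmx1 !mul1mx.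
rewrite !(add_block_mx, add_row_mx, add_col_mx) !scalerA.
rewrite !(mulrN, mulNr, opprK) -/r sqrt2V_sqr !(add0r, addr0) !scaleNr !subrr.
by rewrite row_mx0 col_mx0 !scale_halfD -!scalar_mx_block.
Qed.

(** The middle entry shifts the sign of the lower half, so cancellation and doubling trade places
    compared with even n. *)
Lemma Xmx_odd_sigma nu :
  Xmx_odd nu *m sigma (nu + (1 + nu)) =
  col_mx (r *: sigma nu) (col_mx ((-1) ^+ nu)%:M 0) :> 'cV[R]_(nu + (1 + nu)).
Proof.
rewrite !sigma_add sigma1 /Xmx_odd /block3_mx scale_col_mx.
rewrite mul_block_col mul_row_col mul_col_mx mul_block_col add_col_mx.
rewrite !mul0mx !addr0 !add0r mul1mx -!scalemxAl -!scalemxAr !Jmx_sigma !mul1mx.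
rewrite !scalerA -!scalerDl -/r expr1.
have ee : (-1) ^+ nu * (-1) ^+ nu = 1 :> R by rewrite -expr2 sqrr_sign.
congr (col_mx (_ *: _) (col_mx _ _)).
- by rewrite -[RHS]sqrt2_half; ring: ee.
- by rewrite scale_scalar_mx mulr1.
- by rewrite (_ : _ + _ = 0) ?scale0r //; ring.
Qed.

End SigmaSums.

(** * Reading off the blocks *)

Theorem theorem8 (R : realType) (nu : nat) :
  (forall M : 'M[R]_(nu + nu),
     Mspace R (nu + nu) M <->
     exists (Z : 'M[R]_nu) (a b : 'cV[R]_nu),
       Mspace R nu Z /\
       M = Xmx_even nu
           *m block_mx 0                (a *m (sigma nu)^T)
                       (sigma nu *m b^T) Z
           *m Xmx_even nu)
  /\
  (let eps : R := (-1) ^+ nu in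
   let r2 : R := Num.sqrt 2 in
   let d : R := 2 * nu%:R - 1 in
   let s : 'cV[R]_nu := sigma nu in
   forall M : 'M[R]_(nu + (1 + nu)),
     Mspace R (nu + (1 + nu)) M <->
     exists v x y z : 'cV[R]_nu,
       M = Xmx_odd nu
           *m block3_mx
                ((eps * r2) *: (v *m s^T + s *m y^T)
                 - (eps * (2 * r2 / d) * dotc s (v + y)) *: (s *m s^T))
                v
                ((eps * r2) *: (s *m z^T))
                y^T
                (eps * r2 / d * dotc s (v + y))%:M
                z^T
                ((eps * r2) *: (x *m s^T))
                x
                0
           *m Xmx_odd nu).
Proof.
split=> [M|eps r2 d s M].
  rewrite (Mspace_conjP _ (Xmx_even_tr R nu) (Xmx_evenK R nu)) Xmx_even_sigma.
  set c := - _ * _; have c0 : c != 0.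
    by rewrite mulf_neq0 ?oppr_eq0 ?signr_eq0 ?sqrt2_neq0.
  have prodE (a1 a2 b1 b2 : 'cV[R]_nu) :
      col_mx a1 a2 *m (col_mx 0 (c *: sigma nu))^T
        + col_mx 0 (c *: sigma nu) *m (col_mx b1 b2)^T
      = block_mx 0 ((c *: a1) *m (sigma nu)^T) (sigma nu *m (c *: b1)^T)
          (sigma_sum (c *: a2) (c *: b2)).
    rewrite !tr_col_mx !mul_col_row add_block_mx.
    rewrite !trmx0 /sigma_sum !trmx_scale !mulmx0 !mul0mx !addr0 !add0r.
    by rewrite -!scalemxAl -!scalemxAr.
  (* Only the lower halves enter the constraint, which thus says exactly that the lower right block
     in [prodE] lies in M_nu; the upper halves are free. *)
  have dotE (a1 a2 : 'cV[R]_nu) :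
      dotc (col_mx a1 a2) (col_mx 0 (c *: sigma nu))
      = dotc (c *: a2) (sigma nu).
    by rewrite dotc_col_mx dotc0r add0r dotcZr dotcZl.
  split=> [[A [B [-> AB0]]]|[Z [a [b [/MspaceP[p [q [-> pq0]]] ->]]]]].
    rewrite -[A]vsubmxK -[B]vsubmxK !dotE in AB0 *; rewrite prodE.
    exists (sigma_sum (c *: dsubmx A) (c *: dsubmx B)).
    exists (c *: usubmx A), (c *: usubmx B).
    by split=> //; apply/MspaceP; exists (c *: dsubmx A), (c *: dsubmx B).
  exists (col_mx (c^-1 *: a) (c^-1 *: p)), (col_mx (c^-1 *: b) (c^-1 *: q)).
  by rewrite !dotE prodE !scalerA !divff // !scale1r.
rewrite (Mspace_conjP _ (Xmx_odd_tr R nu) (Xmx_oddK R nu)) Xmx_odd_sigma.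
rewrite -/s -/eps -/r2.
have ee : eps * eps = 1 by rewrite /eps -expr2 sqrr_sign.
have rr : r2 * r2 = 2 := sqrt2_sqr R.
(* 2 nu = 1 is impossible by parity. *)
have d0 : d != 0.
  rewrite subr_eq0 -natrM -[1]/(1%:R) eqr_nat.
  by apply/eqP => /(congr1 odd); rewrite oddM.
set w := col_mx (r2 *: s) _.
have dotE p a q : dotc (col_mx p (col_mx a%:M q)) w = r2 * dotc p s + eps * a.
  by rewrite !dotc_col_mx dotc_scalar dotcZr dotc0r addr0 [a * _]mulrC.
(* v and y are the (1,2) block and the transposed (2,1) block of the product. *)
have prodE p a x q b z :
    dotc (col_mx p (col_mx a%:M x)) w + dotc (col_mx q (col_mx b%:M z)) w = 0 ->
    let v := eps *: p + (r2 * b) *: s in let y := eps *: q + (r2 * a) *: s in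
    col_mx p (col_mx a%:M x) *m w^T + w *m (col_mx q (col_mx b%:M z))^T =
    block3_mx
      ((eps * r2) *: (v *m s^T + s *m y^T)
       - (eps * (2 * r2 / d) * dotc s (v + y)) *: (s *m s^T))
      v ((eps * r2) *: (s *m (eps *: z)^T))
      y^T (eps * r2 / d * dotc s (v + y))%:M (eps *: z)^T
      ((eps * r2) *: (eps *: x *m s^T)) (eps *: x) 0.
  rewrite !dotE => ab0 v y.
  (* The constraint gives eps r2 (P + Q) = -(a + b), with P, Q the products of p, q with s. Hence r2
     s^T (v + y) = (2 nu - 1)(a + b), the source of the denominator d. *)
  have abE : a + b = r2 / d * dotc s (v + y).
    apply: (mulfI d0); rewrite mulrA mulrCA divff // mulr1.
    rewrite !dotcDr !dotcZr dotc_sigma !(dotcC s) /d.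
    move: ab0; set P := dotc p s; set Q := dotc q s => ab0.
    have PQ : eps * r2 * (P + Q) = - (a + b).
      apply: (addrI (eps * eps * (a + b))); rewrite {2}ee mul1r subrr.
      by rewrite -[RHS](mulr0 eps) -ab0; ring.
    transitivity (eps * r2 * (P + Q) + r2 * r2 * nu%:R * (a + b)); last by ring.
    by rewrite PQ rr; ring.
  (* Substituting p = eps (v - r2 b s) and q = eps (y - r2 a s) in r2 (p s^T + s q^T) produces the
     correction 2 eps (a + b) s s^T. *)
  have -> : eps * (2 * r2 / d) * dotc s (v + y) = eps * 2 * (a + b).
    by rewrite abE; ring.
  have -> : eps * r2 / d * dotc s (v + y) = eps * (a + b) by rewrite abE; ring.
  rewrite /w /block3_mx !tr_col_mx !mul_col_row !mul_mx_row !mul_col_mx.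
  rewrite !(add_block_mx, add_row_mx, add_col_mx).
  rewrite !tr_scalar_mx !trmx0 !mulmx0 !mul0mx !addr0 !add0r.
  rewrite !mul_mx_scalar !mul_scalar_mx /v /y; clearbody s.
  congr (block_mx _ (row_mx _ _) (col_mx _ _) (block_mx _ _ _ _));
    apply/matrixP => i j; rewrite !(mxE, big_ord1) ?ord1 //;
    ring: ee rr.
have eK m (u : 'cV[R]_m) : eps *: (eps *: u) = u by rewrite scalerA ee scale1r.
have col3P (A : 'cV[R]_(nu + (1 + nu))) :
    exists p a q, A = col_mx p (col_mx a%:M q).
  exists (usubmx A), (usubmx (dsubmx A) 0 0), (dsubmx (dsubmx A)).
  by rewrite -mx11_scalar !vsubmxK.
split=> [[A [B [-> AB0]]]|[v [x [y [z ->]]]]].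
  have [p [a [x AE]]] := col3P A; have [q [b [z BE]]] := col3P B.
  rewrite {}AE {}BE in AB0 *; rewrite (prodE _ _ _ _ _ _ AB0).
  by do 4![eexists].
(* Adding t w to one vector and subtracting it from the other leaves the product unchanged, so the
   second middle entry b can be taken to be 0. Then [abE] forces a = g, and the formulas for v and y
   in [prodE] give p = eps v and this q. *)
pose g := r2 / d * dotc s (v + y).
pose q := eps *: (y + (- (r2 * g)) *: s).
have AB0 : dotc (col_mx (eps *: v) (col_mx g%:M (eps *: x))) w
    + dotc (col_mx q (col_mx 0%:M (eps *: z))) w = 0.
  have dg : d * g = r2 * (dotc v s + dotc y s).
    by rewrite /g mulrA mulrCA divff // mulr1 !(dotcC _ s) dotcDr.
  rewrite !dotE !dotcZl !dotcDl !dotcZl dotc_sigma.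
  transitivity (eps * (r2 * (dotc v s + dotc y s) + g - r2 * r2 * nu%:R * g)).
    by ring.
  by rewrite -dg rr /d; ring.
exists (col_mx (eps *: v) (col_mx g%:M (eps *: x))).
exists (col_mx q (col_mx 0%:M (eps *: z))).
split=> //; rewrite (prodE _ _ _ _ _ _ AB0) /= !eK mulr0 scale0r addr0.
by rewrite scaleNr subrK.
Qed.
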